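(* For every complex number $x=e^{\mathbf{i}t}$ ($t\in\mathbb{R}$) of modulus $1$ with $x\neq\pm\mathbf{i}$, the symmetric matrix $$M_6(x)=\begin{bmatrix}1&1&1&1&1&1\\1&-1&x&x&-x&-x\\1&x&d&a&b&c\\1&x&a&d&c&b\\1&-x&b&c&p&q\\1&-x&c&b&q&p\end{bmatrix},$$ where $$a=\frac{x^2-2x-1}{4}-\mathbf{i}\,\frac{(x^2-2x-1)\sqrt{16-|x^2-2x-1|^2}}{4|x^2-2x-1|},\qquad d=\frac{x^2-2x-1}{4}+\mathbf{i}\,\frac{(x^2-2x-1)\sqrt{16-|x^2-2x-1|^2}}{4|x^2-2x-1|},$$ $$b=-\frac{1+x^2}{4}-\mathbf{i}\,\frac{(1+x^2)\sqrt{16-|1+x^2|^2}}{4|1+x^2|},\qquad c=-\frac{1+x^2}{4}+\mathbf{i}\,\frac{(1+x^2)\sqrt{16-|1+x^2|^2}}{4|1+x^2|},$$ $$p=\frac{x^2+2x-1}{4}+\mathbf{i}\,\frac{(x^2+2x-1)\sqrt{16-|x^2+2x-1|^2}}{4|x^2+2x-1|},\qquad q=\frac{x^2+2x-1}{4}-\mathbf{i}\,\frac{(x^2+2x-1)\sqrt{16-|x^2+2x-1|^2}}{4|x^2+2x-1|},$$ is a complex Hadamard matrix of order $6$. Moreover, the one-parameter family $\{M_6(x): |x|=1,\ x\ne\pm\mathbf{i}\}$ is non-affine.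
   Context: $\mathbf{i}$ denotes the imaginary unit. A complex Hadamard matrix of order $n$ is an $n\times n$ complex matrix $H$ all of whose entries have modulus $1$ and with $HH^*=nI$. A one-parameter family (set) of $6\times 6$ matrices with unimodular entries is called affine if it is contained in a set of the form $\{[\,h_{jk}e^{\mathbf{i}sr_{jk}}\,]_{j,k=1}^6 : s\in\mathbb{R}\}$ for some fixed matrix $[h_{jk}]$ with unimodular entries and some fixed real $6\times6$ matrix $[r_{jk}]$ (i.e. the phases of all entries depend affinely on one common real parameter); otherwise it is called non-affine. *)

(* Defs.v *)
From mathcomp Require Import all_boot all_order all_algebra.
From mathcomp Require Import complex.
From mathcomp Require Import all_classical all_reals all_analysis.

Set Implicit Arguments.
Unset Strict Implicit.
Unset Printing Implicit Defensive.

Import Order.TTheory GRing.Theory Num.Theory.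

Local Open Scope classical_set_scope.
Local Open Scope ring_scope.
Local Open Scope sesquilinear_scope.

Definition unimodular_mx (R : realType) (n : nat) (H : 'M[R[i]]_n) : Prop :=
  forall j k, `|H j k| = 1.

Definition complex_hadamard (R : realType) (n : nat) (H : 'M[R[i]]_n) : Prop :=
  unimodular_mx H /\ H *m H ^t* = n%:R%:M.

Definition expi (R : realType) (t : R) : R[i] := (cos t +i* sin t)%C.

Definition affine_line (R : realType) (h : 'M[R[i]]_6) (r : 'M[R]_6) :
    set 'M[R[i]]_6 :=
  [set \matrix_(j, k) (h j k * expi (s * r j k)) | s in [set: R]].

Definition affine_family (R : realType) (F : set 'M[R[i]]_6) : Prop :=
  exists (h : 'M[R[i]]_6) (r : 'M[R]_6),
    unimodular_mx h /\ F `<=` affine_line h r.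

Section M6.
Context {R : realType}.
Implicit Types u x : R[i].

(* Here [`|u|] and [sqrtC] take values in R[i]; on unit x all the radicands
   below are nonnegative reals, where sqrtC is the usual square root. *)
Definition M6_root u : R[i] := u * sqrtC (16 - `|u| ^+ 2) / (4 * `|u|).

Definition M6_a x := (x ^+ 2 - 2 * x - 1) / 4 - 'i%C * M6_root (x ^+ 2 - 2 * x - 1).
Definition M6_d x := (x ^+ 2 - 2 * x - 1) / 4 + 'i%C * M6_root (x ^+ 2 - 2 * x - 1).
Definition M6_b x := - ((1 + x ^+ 2) / 4) - 'i%C * M6_root (1 + x ^+ 2).
Definition M6_c x := - ((1 + x ^+ 2) / 4) + 'i%C * M6_root (1 + x ^+ 2).
Definition M6_p x := (x ^+ 2 + 2 * x - 1) / 4 + 'i%C * M6_root (x ^+ 2 + 2 * x - 1).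
Definition M6_q x := (x ^+ 2 + 2 * x - 1) / 4 - 'i%C * M6_root (x ^+ 2 + 2 * x - 1).

Definition M6 x : 'M[R[i]]_6 :=
  let a := M6_a x in let b := M6_b x in let c := M6_c x in
  let d := M6_d x in let p := M6_p x in let q := M6_q x in
  \matrix_(j < 6, k < 6)
    nth 0 (nth [::]
      [:: [:: 1;  1;  1;  1;  1;  1];
          [:: 1; -1;  x;  x; -x; -x];
          [:: 1;  x;  d;  a;  b;  c];
          [:: 1;  x;  a;  d;  c;  b];
          [:: 1; -x;  b;  c;  p;  q];
          [:: 1; -x;  c;  b;  q;  p]] j) k.

End M6.

(* Main.v *)
(* Write [u/4 (1 +- i s)], [s] real, for the pairs (d, a), (b, c), (p, q), with
   [s^2 |u|^2 = 16 - |u|^2]: this makes the entries unimodular and gives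
   [d a^* + a d^* = |u|^2 / 4 - 2].  On the unit circle, [x^2 - 2x - 1] and
   [x^2 + 2x - 1] have the same modulus, hence the same [s], and orthogonality
   of the rows becomes a polynomial identity.

   For non-affinity, note that [d(x) / x] depends only on [x - x^*], i.e. it is
   unchanged under [x |-> - x^*].  If the family were affine, with phases [t p]
   and [t q] for the entries [x] and [d], then [q <> p] since [d(x) / x] is not
   constant, and comparing the points [x] and [- x^*] would give [t] with
   [e^(i t p) = - x^2] and [t (q - p)] in [2 pi Z].  So every unimodular number
   other than 1 would be a power of [e^(2 i pi p / (q - p))], whereas the circle
   group is not cyclic: a square root of a generator [z], being a power
   of [z], would have odd order, hence so would [-1]. *)
Require Import Defs.
From mathcomp Require Import all_boot all_order all_algebra.
From mathcomp Require Import complex.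
From mathcomp Require Import all_classical all_reals all_analysis.
From mathcomp Require Import ring lra.

Set Implicit Arguments.
Unset Strict Implicit.
Unset Printing Implicit Defensive.

Import Order.TTheory GRing.Theory Num.Theory.

Local Open Scope classical_set_scope.
Local Open Scope ring_scope.

(** * Conjugates and moduli of the pairs [u / 4 + j * M6_root u] *)

Section Roots.
Context {R : realType}.
Implicit Types u v x : R[i].

Lemma conjCiC : ('i%C : R[i])^* = - 'i%C.
Proof. by apply/eqP; rewrite eq_complex /= oppr0 !eqxx. Qed.

Lemma conj_div4 u : (u / 4)^* = u^* / 4.
Proof. by rewrite rmorphM /= fmorphV rmorph_nat. Qed.

Definition slope u : R[i] := sqrtC (16 - `|u| ^+ 2) / `|u|.

Lemma M6_rootE u : M6_root u = u / 4 * slope u.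
Proof. by rewrite /M6_root /slope invfM; ring. Qed.

Lemma slope_norm u v : `|u| = `|v| -> slope u = slope v.
Proof. by rewrite /slope => ->. Qed.

Lemma M6_rootMl x u : `|x| = 1 -> M6_root (x * u) = x * M6_root u.
Proof.
move=> x1; rewrite !M6_rootE (@slope_norm (x * u) u) ?normrM ?x1 ?mul1r //.
by rewrite !mulrA.
Qed.

Section Bounded.
Variable u : R[i].
Hypotheses (u0 : u != 0) (u4 : `|u| <= 4).

Lemma conj_slope : (slope u)^* = slope u.
Proof.
apply/CrealP; rewrite rpred_div ?normr_real// sqrtC_real// subr_ge0.
have -> : 16 = 4 ^+ 2 :> R[i] by ring.
by rewrite lerXn2r// nnegrE// ler0n.
Qed.

Lemma slope_sqr : slope u ^+ 2 * (u * u^*) = 16 - u * u^*.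
Proof.
by rewrite -normCK /slope exprMn sqrtCK exprVn mulfVK// expf_neq0 ?normr_eq0.
Qed.

(** The parameter [j] stands for ['i] or [- 'i], so both members of a pair are covered. The squared
    modulus is [|u|^2 (1 + s^2) / 16] with [s] the slope, and [slope_sqr] turns this into 1. *)
Lemma norm_root_pair j :
  j^* = - j -> j ^+ 2 = -1 -> `|u / 4 + j * M6_root u| = 1.
Proof.
move=> jc j2; apply/eqP; rewrite -sqrp_eq1// normCK M6_rootE rmorphD.
rewrite (rmorphM _ j) (rmorphM _ (u / 4)) /= conj_div4 jc conj_slope.
have := slope_sqr; move: (slope u) (u^*) => s w es; apply/eqP.
transitivity (u * w / 16 * (1 - j ^+ 2 * s ^+ 2)); first by field.
by rewrite j2; transitivity ((u * w + s ^+ 2 * (u * w)) / 16);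
  [field|rewrite es; field].
Qed.

End Bounded.
End Roots.

(** * The exponential [expi], its kernel, and the circle group *)

Lemma expiD (R : realType) (s t : R) : expi (s + t) = expi s * expi t.
Proof. by rewrite /expi cosD sinD; simpc; congr (_ +i* _)%C; ring. Qed.

Lemma expi0 (R : realType) : expi (0 : R) = 1.
Proof. by rewrite /expi cos0 sin0. Qed.

Lemma expi_neq0 (R : realType) (t : R) : expi t != 0.
Proof.
apply/eqP => t0; have /eqP := expi0 R.
by rewrite -(subrr t) expiD t0 mul0r eq_sym oner_eq0.
Qed.

Lemma expiN (R : realType) (t : R) : expi (- t) = (expi t)^-1.
Proof.
by apply: (mulfI (expi_neq0 t)); rewrite -expiD subrr expi0 mulfV ?expi_neq0.
Qed.

Lemma expiMz (R : realType) (t : R) (k : int) : expi (t * k%:~R) = expi t ^ k.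
Proof.
have expiMn n : expi (t * n%:R) = expi t ^+ n.
  elim: n => [|n IHn]; first by rewrite mulr0 expi0.
  by rewrite mulrSr mulrDr mulr1 expiD IHn exprSr.
case: k => n; first by rewrite -pmulrn expiMn.
by rewrite NegzE mulrNz mulrN expiN expiMn exprnN.
Qed.

Lemma expi_eq1 (R : realType) (t : R) :
  expi t = 1 -> exists k : int, t = pi *+ 2 * k%:~R.
Proof.
move=> t1; pose p : R := pi *+ 2.
have p0 : 0 < p by rewrite pmulrn_rgt0// pi_gt0.
have p1 : expi p = 1 by rewrite /expi cos2pi sin2pi.
(* Removing whole turns leaves [r] in [[0, 2 pi)], still with [expi r = 1]; it remains to see that
   [r = 0]. *)
pose k := Num.floor (t / p); pose r := t - p * k%:~R.
have /andP[kt tk] : k%:~R <= t / p < (k + 1)%:~R by exact: floor_itv.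
have r0 : 0 <= r by rewrite subr_ge0 mulrC -ler_pdivlMr.
have rp : r < p.
  rewrite ltrBlDr -[X in X + _]mulr1 -mulrDr mulrC.
  by rewrite -ltr_pdivrMr// addrC -[1]/(1%:~R) -intrD.
have r1 : expi r = 1 by rewrite expiD expiN expiMz t1 p1 exp1rz divr1.
exists k; apply/eqP; rewrite -subr_eq0; apply/eqP; rewrite -/p -/r.
have cr : cos r = 1 by case: r1.
have pi0 := pi_ge0 R.
have [rpi|pir] := lerP r pi.
  by apply: cos_inj; rewrite ?in_itv/= ?r0 ?rpi ?lexx ?cos0.
(* Cosine is injective only on [[0, pi]]. For larger [r], the reflection [2 pi - r] lies there and
   has the same cosine, so it would be 0, against [r < 2 pi]. *)
have : p - r = 0.
  apply: cos_inj; rewrite ?in_itv/= ?lexx ?pi0// ?cos0.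
    by apply/andP; split; rewrite /p in rp *; lra.
  by rewrite -cosN opprB -(cosD2pi (r - p)) -/p subrK.
by move=> /eqP; rewrite subr_eq0 => /eqP pr; rewrite pr ltxx in rp.
Qed.

Lemma norm_expi (R : realType) (t : R) : `|expi t| = 1.
Proof. by rewrite normc_def /= cos2Dsin2 sqrtr1. Qed.

Lemma circle_not_cyclic (C : numClosedFieldType) (z : C) : `|z| = 1 ->
  ~ (forall w : C, `|w| = 1 -> w != 1 -> exists k : int, w = z ^ k).
Proof.
move=> z1 gen.
have N1 : (-1 : C) != 1 by rewrite eq_sym -addr_eq0 -mulr2n pnatr_eq0.
have [m zm] := gen (-1) (normrN1 _) N1.
(* Since [gen] says nothing about 1, the chosen root must differ from 1: if [sqrtC z] is 1, then
   [z = 1] and the other root [-1] serves. *)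
have [w [w1 wN1 wz]] : exists w : C, [/\ `|w| = 1, w != 1 & w ^+ 2 = z].
  have r1 : `|sqrtC z| = 1.
    by apply/eqP; rewrite -sqrp_eq1// -normrX sqrtCK z1.
  have [r|r] := eqVneq (sqrtC z) 1; last by exists (sqrtC z); rewrite sqrtCK.
  by exists (-1); rewrite normrN1 sqrrN expr1n -(sqrtCK z) r expr1n.
have [k wk] := gen w w1 wN1.
have w0 : w != 0 by rewrite -normr_eq0 w1 oner_eq0.
have w2 : w ^ 2%:Z = z by [].
(* From [w = z ^ k] and [z = w ^ 2], the odd power [2 k - 1] kills [w], hence also
   [-1 = z ^ m = w ^ (2 m)]; but an odd power of [-1] is [-1]. *)
have wodd : w ^ (k * 2%:Z - 1) = 1.
  by rewrite expfzDr// [k * _]mulrC -exprz_exp w2 -wk divff.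
have : (-1 : C) ^ (k * 2%:Z - 1) = 1.
  by rewrite zm -w2 !exprz_exp mulrA mulrC -exprz_exp wodd exp1rz.
rewrite expfzDr ?oppr_eq0 ?oner_eq0// [k * _]mulrC -exprz_exp.
rewrite -exprnP sqrrN expr1n exp1rz mul1r.
by rewrite exprN1 invrN1 => /eqP; apply/negP.
Qed.

(** * The quadratic factors on the unit circle *)

Section UnitCircle.
Context {R : realType}.
Variable x : R[i].
Hypothesis x1 : `|x| = 1.

Lemma unit_neq0 : x != 0.
Proof. by rewrite -normr_eq0 x1 oner_eq0. Qed.

Lemma unit_mul_conj : x * x^* = 1.
Proof. by rewrite -normCK x1 expr1n. Qed.

Lemma M6_uE : x ^+ 2 - 2 * x - 1 = x * (x - x^* - 2).
Proof. by rewrite -unit_mul_conj; ring. Qed.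

Lemma M6_wE : x ^+ 2 + 2 * x - 1 = x * (x - x^* + 2).
Proof. by rewrite -unit_mul_conj; ring. Qed.

Lemma conj_M6_u : (x ^+ 2 - 2 * x - 1)^* = x^* ^+ 2 - 2 * x^* - 1.
Proof. by rewrite !rmorphB rmorphXn rmorphM /= rmorph_nat rmorph1. Qed.

Lemma conj_M6_w : (x ^+ 2 + 2 * x - 1)^* = x^* ^+ 2 + 2 * x^* - 1.
Proof. by rewrite !rmorphB rmorphD rmorphXn rmorphM /= rmorph_nat rmorph1. Qed.

Lemma conj_M6_v : (1 + x ^+ 2)^* = 1 + x^* ^+ 2.
Proof. by rewrite rmorphD rmorphXn rmorph1. Qed.

Lemma norm_M6_u_le4 : `|x ^+ 2 - 2 * x - 1| <= 4.
Proof.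
have -> : 4 = 1 + 2 + 1 :> R[i] by ring.
apply: le_trans (ler_normB _ _) _; rewrite normr1 lerD2r.
apply: le_trans (ler_normB _ _) _.
by rewrite normrX normrM x1 expr1n mulr1 normr_nat.
Qed.

Lemma norm_M6_w_le4 : `|x ^+ 2 + 2 * x - 1| <= 4.
Proof.
have -> : 4 = 1 + 2 + 1 :> R[i] by ring.
apply: le_trans (ler_normB _ _) _; rewrite normr1 lerD2r.
apply: le_trans (ler_normD _ _) _.
by rewrite normrX normrM x1 expr1n mulr1 normr_nat.
Qed.

Lemma norm_M6_v_le4 : `|1 + x ^+ 2| <= 4.
Proof.
apply: le_trans (ler_normD _ _) _; rewrite normr1 normrX x1 expr1n.
by rewrite -mulr2n ler_nat.
Qed.

Lemma conj_subC2 : (x - x^* - 2)^* = x^* - x - 2.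
Proof. by rewrite (rmorphB _ (x - _)) rmorphB /= conjCK rmorph_nat. Qed.

(** As [x - x^*] is purely imaginary, the cofactors [x - x^* - 2] and [x - x^* + 2] are conjugate up
    to sign. *)
Lemma norm_M6_uw : `|x ^+ 2 - 2 * x - 1| = `|x ^+ 2 + 2 * x - 1|.
Proof.
have -> : x ^+ 2 + 2 * x - 1 = x * - (x - x^* - 2)^*.
  by rewrite conj_subC2 M6_wE; ring.
by rewrite M6_uE !normrM normrN norm_conjC.
Qed.

(** Its real part is [-2]: adding the conjugate gives [-4]. *)
Lemma unit_sub_conj_neq : x - x^* - 2 != 0.
Proof.
apply/eqP => e.
have : (x - x^* - 2)^* = 0 by rewrite e rmorph0.
rewrite conj_subC2 => e'.
have : (x - x^* - 2) + (x^* - x - 2) = 0 by rewrite e e' addr0.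
have -> : (x - x^* - 2) + (x^* - x - 2) = - 4 by ring.
by apply/eqP; rewrite oppr_eq0 pnatr_eq0.
Qed.

Lemma M6_u_neq0 : x ^+ 2 - 2 * x - 1 != 0.
Proof. by rewrite M6_uE mulf_neq0 ?unit_neq0 ?unit_sub_conj_neq. Qed.

Lemma M6_w_neq0 : x ^+ 2 + 2 * x - 1 != 0.
Proof. by rewrite -normr_eq0 -norm_M6_uw normr_eq0 M6_u_neq0. Qed.

Lemma M6_v_neq0 : x <> 'i%C -> x <> - 'i%C -> 1 + x ^+ 2 != 0.
Proof.
move=> xi xNi; apply/eqP => e.
have : (x - 'i%C) * (x + 'i%C) == 0.
  by rewrite -subr_sqr sqr_i opprK addrC e.
by rewrite mulf_eq0 subr_eq0 addr_eq0 => /orP[] /eqP.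
Qed.

End UnitCircle.

(** The terms linear in the slope [s] cancel, leaving [|u|^2 (1 - s^2) / 8]; [slope_sqr] then
    eliminates [s]. *)
Lemma root_pair_cross (R : realType) (u j : R[i]) :
    u != 0 -> `|u| <= 4 -> j^* = - j -> j ^+ 2 = -1 ->
  (u / 4 + j * M6_root u) * (u / 4 - j * M6_root u)^* +
  (u / 4 - j * M6_root u) * (u / 4 + j * M6_root u)^* = u * u^* / 4 - 2.
Proof.
move=> u0 u4 jc j2; rewrite M6_rootE (rmorphB _ (u / 4)) (rmorphD _ (u / 4)).
rewrite (rmorphM _ j) (rmorphM _ (u / 4)) /= conj_div4 jc conj_slope//.
have := slope_sqr u0; move: (slope u) (u^*) => s w es.
transitivity (u * w / 8 * (1 + j ^+ 2 * s ^+ 2)); first by field.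
rewrite j2; transitivity ((u * w - s ^+ 2 * (u * w)) / 8); first by field.
by rewrite es; field.
Qed.

Lemma conj_root_pair (R : realType) (u j : R[i]) :
  u != 0 -> `|u| <= 4 -> j^* = - j ->
  (u / 4 + j * M6_root u)^* = u^* / 4 * (1 - j * slope u).
Proof.
move=> nz le4 jc; rewrite M6_rootE (rmorphD _ (u / 4)).
by rewrite (rmorphM _ j) (rmorphM _ (u / 4)) /= conj_div4 jc conj_slope//; ring.
Qed.

Lemma M6_sym (R : realType) (x : R[i]) : (M6 x)^T = M6 x.
Proof.
apply/matrixP => j k; rewrite !mxE.
by case: j k => [[|[|[|[|[|[|j]]]]]] jlt] [[|[|[|[|[|[|k]]]]]] klt].
Qed.

(** * Unimodularity and orthogonality of the rows *)

Section Hadamard.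
Context {R : realType}.
Variable x : R[i].
Hypotheses (x1 : `|x| = 1) (xi : x <> 'i%C) (xNi : x <> - 'i%C).

Let ci : ('i%C : R[i])^* = - 'i%C := conjCiC.
Let i2 : ('i%C : R[i]) ^+ 2 = -1 := sqr_i R.
Let cNi : (- 'i%C : R[i])^* = - - 'i%C.
Proof. by rewrite rmorphN /= ci. Qed.
Let Ni2 : (- 'i%C : R[i]) ^+ 2 = -1.
Proof. by rewrite sqrrN i2. Qed.

Let u0 := M6_u_neq0 x1.
Let u4 := norm_M6_u_le4 x1.
Let w0 := M6_w_neq0 x1.
Let w4 := norm_M6_w_le4 x1.
Let v0 := M6_v_neq0 xi xNi.
Let v4 := norm_M6_v_le4 x1.

Lemma M6_bE : M6_b x = - ((1 + x ^+ 2) / 4 + 'i%C * M6_root (1 + x ^+ 2)).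
Proof. by rewrite opprD. Qed.

Lemma M6_cE : M6_c x = - ((1 + x ^+ 2) / 4 - 'i%C * M6_root (1 + x ^+ 2)).
Proof. by rewrite opprB addrC. Qed.

Lemma norm_M6_d : `|M6_d x| = 1.
Proof. exact: norm_root_pair. Qed.

Lemma norm_M6_a : `|M6_a x| = 1.
Proof. by rewrite /M6_a -(mulNr 'i%C); exact: norm_root_pair. Qed.

Lemma norm_M6_p : `|M6_p x| = 1.
Proof. exact: norm_root_pair. Qed.

Lemma norm_M6_q : `|M6_q x| = 1.
Proof. by rewrite /M6_q -(mulNr 'i%C); exact: norm_root_pair. Qed.

Lemma norm_M6_b : `|M6_b x| = 1.
Proof. by rewrite M6_bE normrN; exact: norm_root_pair. Qed.

Lemma norm_M6_c : `|M6_c x| = 1.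
Proof. by rewrite M6_cE normrN -(mulNr 'i%C); exact: norm_root_pair. Qed.

Lemma M6_unimodular : unimodular_mx (M6 x).
Proof.
move=> j k; rewrite !mxE.
case: j k => [[|[|[|[|[|[|j]]]]]] jlt] [[|[|[|[|[|[|k]]]]]] klt] //=;
  by rewrite ?normrN ?normr1 ?x1 ?norm_M6_a ?norm_M6_b ?norm_M6_c ?norm_M6_d
    ?norm_M6_p ?norm_M6_q.
Qed.

Let A := slope (x ^+ 2 - 2 * x - 1).
Let B := slope (1 + x ^+ 2).

Let slope_w : slope (x ^+ 2 + 2 * x - 1) = A.
Proof. by rewrite /A (slope_norm (norm_M6_uw x1)). Qed.

Let xV : x^* = x^-1.
Proof. by rewrite -[LHS](mulKf (unit_neq0 x1)) unit_mul_conj// mulr1. Qed.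

Let conj_d : (M6_d x)^* = (x^-1 ^+ 2 - 2 * x^-1 - 1) / 4 * (1 - 'i%C * A).
Proof. by rewrite /M6_d conj_root_pair// conj_M6_u xV. Qed.

Let conj_a : (M6_a x)^* = (x^-1 ^+ 2 - 2 * x^-1 - 1) / 4 * (1 + 'i%C * A).
Proof.
by rewrite /M6_a -(mulNr 'i%C) conj_root_pair// conj_M6_u xV (mulNr 'i%C) opprK.
Qed.

Let conj_p : (M6_p x)^* = (x^-1 ^+ 2 + 2 * x^-1 - 1) / 4 * (1 - 'i%C * A).
Proof. by rewrite /M6_p conj_root_pair// conj_M6_w xV slope_w. Qed.

Let conj_q : (M6_q x)^* = (x^-1 ^+ 2 + 2 * x^-1 - 1) / 4 * (1 + 'i%C * A).
Proof.
rewrite /M6_q -(mulNr 'i%C) conj_root_pair// conj_M6_w xV slope_w.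
by rewrite (mulNr 'i%C) opprK.
Qed.

Let conj_b : (M6_b x)^* = - ((1 + x^-1 ^+ 2) / 4 * (1 - 'i%C * B)).
Proof. by rewrite M6_bE rmorphN /= conj_root_pair// conj_M6_v xV. Qed.

Let conj_c : (M6_c x)^* = - ((1 + x^-1 ^+ 2) / 4 * (1 + 'i%C * B)).
Proof.
rewrite M6_cE -(mulNr 'i%C) rmorphN /= conj_root_pair// conj_M6_v xV.
by rewrite (mulNr 'i%C) opprK.
Qed.

(** The two cross sums are [|u|^2 / 4 - 2] and [|v|^2 / 4 - 2] with [u = x^2 - 2x - 1] and
    [v = 1 + x^2], and [|u|^2 + |v|^2 = 8] on the circle. *)
Let cross_ad : M6_d x * (M6_a x)^* + M6_a x * (M6_d x)^* +
  (M6_b x * (M6_c x)^* + M6_c x * (M6_b x)^*) = - 2.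
Proof.
rewrite M6_bE M6_cE !(rmorphN Num.conj) !mulrNN !root_pair_cross//.
by rewrite conj_M6_u conj_M6_v xV; field; exact: unit_neq0.
Qed.

Let cross_pq : M6_p x * (M6_q x)^* + M6_q x * (M6_p x)^* +
  (M6_b x * (M6_c x)^* + M6_c x * (M6_b x)^*) = - 2.
Proof.
rewrite M6_bE M6_cE !(rmorphN Num.conj) !mulrNN !root_pair_cross//.
by rewrite conj_M6_w conj_M6_v xV; field; exact: unit_neq0.
Qed.

Lemma M6_orthogonal (j k : 'I_6) : j != k -> \sum_l M6 x j l * (M6 x k l)^* = 0.
Proof.
have conj1 : (1 : R[i])^* = 1 := rmorph1 _.
have conjN1 : (- 1 : R[i])^* = - 1 by rewrite rmorphN /= conj1.
have conjNx : (- x)^* = - x^-1 by rewrite rmorphN /= xV.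
have xVx : x / x = 1 by rewrite divff ?unit_neq0.
have x0 := unit_neq0 x1.
rewrite !big_ord_recl big_ord0 addr0 !mxE.
case: j k => [[|[|[|[|[|[|j]]]]]] jlt] [[|[|[|[|[|[|k]]]]]] klt] //= _;
  rewrite ?conj1 ?conjN1 ?conjNx ?xV.
(* For the rows of index 2 and 3 the product is [1 + x / x] plus the sum in [cross_ad]; the rows of
   index 4 and 5 use [cross_pq] in the same way. *)
all: try by transitivity (1 + x / x + - 2 : R[i]);
  [rewrite -cross_ad; ring|rewrite xVx; ring].
all: try by transitivity (1 + x / x + - 2 : R[i]);
  [rewrite -cross_pq; ring|rewrite xVx; ring].
(* All other products vanish as rational identities in [x], [A] and [B], with the slopes [A] and [B]
   as free symbols. *)
all: rewrite ?conj_a ?conj_b ?conj_c ?conj_d ?conj_p ?conj_q.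
all: rewrite /M6_a /M6_b /M6_c /M6_d /M6_p /M6_q ?M6_rootE ?slope_w -/A -/B.
all: try by field.
Qed.

Lemma M6_hadamard : complex_hadamard (M6 x).
Proof.
split; first exact: M6_unimodular.
apply/matrixP => j k; rewrite [RHS]mxE.
transitivity (\sum_l M6 x j l * (M6 x k l)^*).
  by rewrite mxE; apply: eq_bigr => l _; congr (_ * _); rewrite !mxE.
have [<-|jk] := eqVneq j k; last exact: M6_orthogonal.
rewrite mulr1n -[in RHS](card_ord 6) -sumr_const.
by apply: eq_bigr => l _; rewrite -normCK M6_unimodular expr1n.
Qed.

End Hadamard.

(** * Non-affinity of the family *)

Section NonAffine.
Context {R : realType}.
Implicit Types (x y w : R[i]).

Definition M6_domain : set R[i] :=
  [set x : R[i] | [/\ `|x| = 1, x <> 'i%C & x <> - 'i%C]].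

Lemma sqr_neqN1_domain x : `|x| = 1 -> x ^+ 2 != -1 -> M6_domain x.
Proof.
move=> x1 xN1; split=> // e; move: xN1; rewrite e ?sqrrN sqr_i eqxx//.
Qed.

Lemma M6_dMl x : `|x| = 1 ->
  M6_d x = x * ((x - x^* - 2) / 4 + 'i%C * M6_root (x - x^* - 2)).
Proof.
by move=> x1; rewrite /M6_d M6_uE// M6_rootMl//; ring.
Qed.

(** The map [x |-> - x^*] fixes [x - x^*], so only the prefactor [x] in [M6_dMl] changes. *)
Lemma M6_d_reflect x : `|x| = 1 -> M6_d (- x^*) = - (x^* / x) * M6_d x.
Proof.
move=> x1; rewrite !M6_dMl ?normrN ?norm_conjC//.
have -> : - x^* - (- x^*)^* - 2 = x - x^* - 2.
  by rewrite rmorphN /= conjCK; ring.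
by field; exact: unit_neq0.
Qed.

(* [u = x - x^* - 2] and its conjugate share the same slope, so equality of the
   two values forces [u = u^*] unless [1 + 'i * slope u = 0], i.e. [d = 0]. *)
Lemma M6_d_conj_real x : M6_domain x ->
  M6_d (x^*) = x^* / x * M6_d x -> x^* = x.
Proof.
move=> [x1 xi xNi]; have x0 := unit_neq0 x1.
have xc1 : `|x^*| = 1 by rewrite norm_conjC.
rewrite !M6_dMl// conjCK !M6_rootE [X in _ = X -> _]mulrA divfK//.
have sl : slope (x^* - x - 2) = slope (x - x^* - 2).
  by apply: slope_norm; rewrite -conj_subC2 norm_conjC.
move/(mulfI (unit_neq0 xc1)); rewrite sl => /eqP; rewrite -subr_eq0.
have := norm_M6_d x1; rewrite M6_dMl// M6_rootE.
set s := slope _ => d1.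
have -> : (x^* - x - 2) / 4 + 'i%C * ((x^* - x - 2) / 4 * s) -
   ((x - x^* - 2) / 4 + 'i%C * ((x - x^* - 2) / 4 * s)) =
   (x^* - x) * ((1 + 'i%C * s) / 2) by field.
rewrite mulf_eq0 subr_eq0 => /orP[/eqP//|].
rewrite mulf_eq0 invr_eq0 pnatr_eq0 orbF.
move=> /eqP s0; move: d1.
have -> : x * ((x - x^* - 2) / 4 + 'i%C * ((x - x^* - 2) / 4 * s)) =
  x * (x - x^* - 2) / 4 * (1 + 'i%C * s) by field.
by rewrite s0 mulr0 normr0 => /eqP; rewrite eq_sym oner_eq0.
Qed.

(** Quotients of entries at two points cancel the base matrix [h], leaving pure phases in the
    difference of the two parameters. The entries compared are [x] and [d]. *)
Lemma M6_affine_ratio (h : 'M[R[i]]_6) (r : 'M[R]_6) :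
  [set M6 x | x in M6_domain] `<=` affine_line h r ->
  exists p q : R, forall x y, M6_domain x -> M6_domain y ->
    exists t : R, expi (t * p) = x / y /\ expi (t * q) = M6_d x / M6_d y.
Proof.
move=> sub; pose i1 : 'I_6 := inord 1; pose i2 : 'I_6 := inord 2.
exists (r i1 i2), (r i2 i2).
have val x : M6_domain x -> exists s : R,
    x = h i1 i2 * expi (s * r i1 i2) /\ M6_d x = h i2 i2 * expi (s * r i2 i2).
  move=> xD; have [s _ /matrixP e] := sub _ (ex_intro2 _ _ x xD erefl).
  by exists s; split; [have := e i1 i2|have := e i2 i2]; rewrite !mxE !inordK.
move=> x y xD yD; have [s [xs ds]] := val x xD; have [t [yt dt]] := val y yD.
have y0 : y != 0 by apply: unit_neq0; case: yD.
have dy0 : M6_d y != 0 by rewrite -normr_eq0 norm_M6_d ?oner_eq0//; case: yD.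
exists (s - t); rewrite !mulrBl !expiD !expiN ds dt xs yt.
move: y0 dy0; rewrite dt yt !mulf_eq0 !negb_or => /andP[h1 _] /andP[h2 _].
by split; rewrite -mulf_div divff// mul1r.
Qed.

Lemma M6_not_affine : ~ affine_family [set M6 x | x in M6_domain].
Proof.
move=> [h [r [_ /M6_affine_ratio[p [q pq]]]]].
have dn0 x : M6_domain x -> M6_d x != 0.
  by move=> [x1 _ _]; rewrite -normr_eq0 norm_M6_d ?oner_eq0.
have qp : q - p != 0.
  apply/eqP => qp.
  (* Equal rates would make [d(x) / x] constant. At [x] and [x^*] this forces [x] to be real,
     whereas [x^2 = 'i] is not 1. *)
  pose x : R[i] := sqrtC 'i%C.
  have x1 : `|x| = 1.
    apply/eqP; rewrite -sqrp_eq1// -normrX sqrtCK.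
    by rewrite -sqrp_eq1// -normrX sqr_i normrN1.
  have xD : M6_domain x.
    apply: sqr_neqN1_domain => //; rewrite sqrtCK eq_complex /=.
by rewrite oppr0 oner_eq0 andbF.
  have xcD : M6_domain x^*.
    apply: sqr_neqN1_domain; rewrite ?norm_conjC// -rmorphXn /= sqrtCK conjCiC.
    by rewrite eqr_opp eq_complex /= negb_and oner_eq0 orbT.
  have [t [tp tq]] := pq _ _ xcD xD.
  have xx : x^* = x.
    apply: M6_d_conj_real => //; rewrite -tp -(subrK p q) qp add0r in tq *.
    by rewrite tq divfK// dn0.
  have := unit_mul_conj x1; rewrite xx -expr2 sqrtCK => /eqP.
  by rewrite eq_complex /= oner_eq0 andbF.
(* If [t (q - p) = 2 pi k], then [expi (t * p) = z ^ k]. *)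
pose z := expi (pi *+ 2 / (q - p) * p).
apply: (@circle_not_cyclic _ z); first exact: norm_expi.
(* This choice makes the quotient of [x] by [- x^*] equal to [- x^2 = w]; the condition [w != 1]
   keeps both points away from ['i] and [- 'i]. *)
move=> w w1 wN1; pose x : R[i] := sqrtC (- w).
have x1 : `|x| = 1 by apply/eqP; rewrite -sqrp_eq1// -normrX sqrtCK normrN w1.
have x0 := unit_neq0 x1.
have xV : x^* = x^-1 by rewrite -[LHS](mulKf x0) unit_mul_conj// mulr1.
have xD : M6_domain x by apply: sqr_neqN1_domain => //; rewrite sqrtCK eqr_opp.
have yD : M6_domain (- x^*).
  apply: sqr_neqN1_domain; rewrite ?normrN ?norm_conjC// sqrrN xV exprVn sqrtCK.
  by rewrite invrN eqr_opp invr_eq1.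
have [t [tp tq]] := pq _ _ xD yD.
have xy : x / - x^* = w by rewrite xV invrN invrK mulrN -expr2 sqrtCK opprK.
have dd : M6_d x / M6_d (- x^*) = w.
  by rewrite M6_d_reflect// -xy xV; field; rewrite x0 dn0.
(* Both phases [t * p] and [t * q] represent [w], so their difference lies in the kernel of
   [expi]. *)
have [k tk] : exists k : int, t * (q - p) = pi *+ 2 * k%:~R.
  apply: expi_eq1; rewrite mulrBr expiD expiN tp tq xy dd divff//.
  by rewrite -normr_eq0 w1 oner_eq0.
exists k; rewrite -expiMz -xy -tp; congr expi.
by apply: (mulIf qp); rewrite mulrAC tk; field.
Qed.

End NonAffine.

Theorem theorem3p3 (R : realType) :
  (forall x : R[i], `|x| = 1 -> x <> 'i%C -> x <> - 'i%C ->
     (M6 x)^T = M6 x /\ complex_hadamard (M6 x)) /\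
  ~ affine_family
      [set M6 x | x in [set x : R[i] | [/\ `|x| = 1, x <> 'i%C & x <> - 'i%C]]].
Proof.
split=> [x x1 xi xNi|]; last exact: M6_not_affine.
by split; [exact: M6_sym|exact: M6_hadamard].
Qed.
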